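(* If a primal ray exists, then the dual problem is infeasible (it has no dual feasible solution); and if a dual ray exists, then the primal problem is infeasible (it has no primal feasible solution).
   Context: Setting. $I$ and $J$ are finite sets, $c\in\mathbb{R}^J$, and for each $i\in I$, $M_i$ is a finite set, $F^i:\mathbb{R}^J\to\mathbb{R}^{M_i}$ and $g_i:\mathbb{R}^{M_i}\to\mathbb{R}\cup\{+\infty\}$. Write $\mathbb{R}^M:=\prod_{i\in I}\mathbb{R}^{M_i}$, so $y\in\mathbb{R}^M$ has blocks $y^i\in\mathbb{R}^{M_i}$, and $w\in\mathbb{R}^{I\times J}$ has blocks $w^i\in\mathbb{R}^J$. $(g_i\circ F^i)(x):=g_i(F^i(x))$. Standing assumptions, for each $i\in I$: (i) there is $\bar{x}^i\in\mathbb{R}^J$ with $g_i(F^i(\bar{x}^i))<+\infty$; (ii) $F^i$ is continuously differentiable; (iii) $g_i$ is a proper, closed (lower semicontinuous) and convex function; (iv) $(x,u)\mapsto g_i(F^i(x)+u)$ is jointly convex in $(x,u)\in\mathbb{R}^J\times\mathbb{R}^{M_i}$. Notation. $\nabla F^i(x)\in\mathbb{R}^{M_i\times J}$ is the Jacobian of $F^i$ at $x$; $g_i^*(v):=\sup_{z\in\mathbb{R}^{M_i}}\{v\cdot z-g_i(z)\}$ is the convex conjugate; $F^i_\nabla(y^i,w^i):=(\nabla F^i(w^i)w^i-F^i(w^i))\cdot y^i$. For a proper closed convex $h:\mathbb{R}^L\to\mathbb{R}\cup\{+\infty\}$, its asymptotic (horizon) function is $h_\infty(d):=\sup_{t>0}\frac{h(\bar{z}+td)-h(\bar{z})}{t}$,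 where $\bar{z}$ is an arbitrary point with $h(\bar{z})<+\infty$. Primal problem: $\inf_{x\in\mathbb{R}^J} c\cdot x+\sum_{i\in I}g_i(F^i(x))$. Dual problem: $\sup_{y\in\mathbb{R}^M,\,w\in\mathbb{R}^{I\times J}}\; -\sum_{i\in I}\left(F^i_\nabla(-y^i,w^i)+g_i^*(-y^i)\right)$ subject to $\sum_{i\in I}\nabla F^i(w^i)^Ty^i=c$. Feasibility. $\bar{x}\in\mathbb{R}^J$ is primal feasible if $g_i(F^i(\bar{x}))<+\infty$ for all $i\in I$. $(\bar{y},\bar{w})\in\mathbb{R}^M\times\mathbb{R}^{I\times J}$ is dual feasible if $g_i^*(-\bar{y}^i)<+\infty$ for all $i\in I$ and $\sum_{i\in I}\nabla F^i(\bar{w}^i)^T\bar{y}^i=c$. Rays. A primal ray is $\hat{x}\in\mathbb{R}^J$ with $c\cdot\hat{x}+\sum_{i\in I}(g_i\circ F^i)_\infty(\hat{x})<0$. A dual ray is $(\hat{y},\hat{w})\in\mathbb{R}^M\times\mathbb{R}^{I\times J}$ with $\sum_{i\in I}\nabla F^i(\hat{w}^i)^T\hat{y}^i=0$ and $-\sum_{i\in I}\left(F^i_\nabla(-\hat{y}^i,\hat{w}^i)+(g_i^* )_\infty(-\hat{y}^i)\right)>0$. *)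

(* Defs.v *)
From HB Require Import structures.
From mathcomp Require Import all_boot all_order all_algebra.
From mathcomp Require Import all_classical all_reals all_analysis.

Set Implicit Arguments.
Unset Strict Implicit.
Unset Printing Implicit Defensive.

Import Order.TTheory GRing.Theory Num.Theory.
Import numFieldNormedType.Exports.

Local Open Scope classical_set_scope.
Local Open Scope ring_scope.

(* The finite sets J and M_i are taken to be {0, ..., n - 1} and
   {0, ..., m i - 1}, and vectors are row vectors.  The library's Jacobian
   'J F x : 'M_(n, m) acts on row vectors from the right, so it is the
   transpose of the usual Jacobian matrix: v *m 'J F x is the directional
   derivative of F at x along v. *)

Definition dot (R : realType) (k : nat) (u v : 'rV[R]_k) : R :=
  \sum_(j < k) u 0 j * v 0 j.

Definition continuously_differentiable (R : realType) (n m : nat)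
    (F : 'rV[R]_n -> 'rV[R]_m) : Prop :=
  (forall x, differentiable F x) /\ continuous (fun x => 'J F x).

Section ExtendedValued.
Local Open Scope ereal_scope.

Definition proper_fun (R : realType) (V : Type) (h : V -> \bar R) : Prop :=
  (forall z, h z != -oo) /\ exists z, h z < +oo.

(* The library's [convex_function] is for real-valued functions only. *)
Definition econvex (R : realType) (V : lmodType R) (h : V -> \bar R) : Prop :=
  forall (x y : V) (t : R), (0 < t < 1)%R ->
    h (t *: x + (1 - t) *: y)%R <= t%:E * h x + (1 - t)%:E * h y.

Definition conjugate (R : realType) (k : nat) (h : 'rV[R]_k -> \bar R)
    (v : 'rV[R]_k) : \bar R :=
  ereal_sup [set (dot v z)%:E - h z | z in [set: 'rV[R]_k]].

(* The base point is a point of the effective domain of h picked by the choice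
   operator, about which nothing else is known; when h is proper, closed and
   convex such a point exists and the value does not depend on it. *)
Definition horizon (R : realType) (k : nat) (h : 'rV[R]_k -> \bar R)
    (d : 'rV[R]_k) : \bar R :=
  let z := xget 0%R [set z | h z < +oo] in
  ereal_sup [set (h (z + t *: d)%R - h z) * (t^-1)%:E | t in [set t : R | (0 < t)%R]].

End ExtendedValued.

Section Problem.
Local Open Scope ereal_scope.

Definition Fnabla (R : realType) (n m : nat) (F : 'rV[R]_n -> 'rV[R]_m)
    (y : 'rV[R]_m) (w : 'rV[R]_n) : R :=
  dot (w *m 'J F w - F w)%R y.

Definition primal_feasible (R : realType) (I : finType) (n : nat) (m : I -> nat)
    (F : forall i, 'rV[R]_n -> 'rV[R]_(m i))
    (g : forall i, 'rV[R]_(m i) -> \bar R) (x : 'rV[R]_n) : Prop :=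
  forall i, g i (F i x) < +oo.

Definition dual_feasible (R : realType) (I : finType) (n : nat) (m : I -> nat)
    (c : 'rV[R]_n) (F : forall i, 'rV[R]_n -> 'rV[R]_(m i))
    (g : forall i, 'rV[R]_(m i) -> \bar R)
    (y : forall i, 'rV[R]_(m i)) (w : I -> 'rV[R]_n) : Prop :=
  (forall i, conjugate (g i) (- y i)%R < +oo) /\
  (\sum_(i : I) y i *m ('J (F i) (w i))^T)%R = c.

Definition primal_ray (R : realType) (I : finType) (n : nat) (m : I -> nat)
    (c : 'rV[R]_n) (F : forall i, 'rV[R]_n -> 'rV[R]_(m i))
    (g : forall i, 'rV[R]_(m i) -> \bar R) (x : 'rV[R]_n) : Prop :=
  (dot c x)%:E + \sum_(i : I) horizon (g i \o F i) x < 0.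

Definition dual_ray (R : realType) (I : finType) (n : nat) (m : I -> nat)
    (F : forall i, 'rV[R]_n -> 'rV[R]_(m i))
    (g : forall i, 'rV[R]_(m i) -> \bar R)
    (y : forall i, 'rV[R]_(m i)) (w : I -> 'rV[R]_n) : Prop :=
  (\sum_(i : I) y i *m ('J (F i) (w i))^T)%R = 0%R /\
  0 < - \sum_(i : I) ((Fnabla (F i) (- y i)%R (w i))%:E
                      + horizon (conjugate (g i)) (- y i)%R).

End Problem.

(* Main.v *)
Require Import Defs.
From HB Require Import structures.
From mathcomp Require Import all_boot all_order all_algebra.
From mathcomp Require Import all_classical all_reals all_analysis.
From mathcomp Require Import ring lra.

Set Implicit Arguments.
Unset Strict Implicit.
Unset Printing Implicit Defensive.

Import Order.TTheory GRing.Theory Num.Theory.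
Import numFieldNormedType.Exports.

Local Open Scope classical_set_scope.
Local Open Scope ring_scope.

(** The two implications are mirror images, and both rest on one fact: for v in
    the domain of the conjugate g^*, the function x |-> v . F x is convex.
    Indeed, substituting z = F x + u in the definition of g^* v,
      v . F x - g^* v = inf_u (g (F x + u) - v . u),
    and a partial infimum of a jointly convex function is convex.  Convexity and
    differentiability give the tangent inequality at any w,
      v . F x >= x . (J_w v) - Fnabla v w,
    where J_w v is v paired with the Jacobian of F at w; the constant terms of
    the affine minorant are exactly what Fnabla collects.

    Primal ray x, dual feasible (y, w).  With v = - y, the Fenchel-Young
    inequality g (F z) >= v . F z - g^* v and the tangent inequality show that
    g o F lies above an affine function of slope J_w v, so its horizon function
    at x is at least x . (J_w v) ([horizon_comp_ge]).  Summed over the blocks,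
    the constraint on (y, w) turns these lower bounds into - c . x, so x cannot
    be a primal ray.

    Dual ray (y, w), primal feasible x.  Again v = - y.  If the horizon function
    of g^* at v is at most q, then g^* (u + t v) <= g^* u + t q for some u and
    all t > 0.  Hence u + t v stays in the domain of g^*; dividing by t and
    letting t grow, v . F is convex, and v . F x <= q because g (F x) is finite.
    The tangent inequality then gives x . (J_w v) <= Fnabla v w + q
    ([horizon_conjugate_ge]).  Over the blocks, the left sides add up to 0, so
    (y, w) cannot be a dual ray.

    The second argument needs a base point u at which g^* is finite, that is, an
    affine minorant of g.  It comes from separating a point below the graph of g
    from the epigraph, by means of a nearest point of the epigraph
    ([conjugate_dom_neq0]). *)

(** * The dot product *)

Lemma dotE (R : realType) k (u v : 'rV[R]_k) : dot u v = (u *m v^T) 0 0.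
Proof. by rewrite mxE; apply: eq_bigr => j _; rewrite mxE. Qed.

Lemma dotC (R : realType) k (u v : 'rV[R]_k) : dot u v = dot v u.
Proof. by apply: eq_bigr => j _; rewrite mulrC. Qed.

Lemma dotDl (R : realType) k (u u' v : 'rV[R]_k) :
  dot (u + u') v = dot u v + dot u' v.
Proof. by rewrite !dotE mulmxDl mxE. Qed.

Lemma dotNl (R : realType) k (u v : 'rV[R]_k) : dot (- u) v = - dot u v.
Proof. by rewrite !dotE mulNmx mxE. Qed.

Lemma dotZl (R : realType) k a (u v : 'rV[R]_k) : dot (a *: u) v = a * dot u v.
Proof. by rewrite !dotE -scalemxAl mxE. Qed.

Lemma dotDr (R : realType) k (u v v' : 'rV[R]_k) :
  dot u (v + v') = dot u v + dot u v'.
Proof. by rewrite dotC dotDl !(dotC u). Qed.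

Lemma dotNr (R : realType) k (u v : 'rV[R]_k) : dot u (- v) = - dot u v.
Proof. by rewrite dotC dotNl dotC. Qed.

Lemma dotZr (R : realType) k a (u v : 'rV[R]_k) : dot u (a *: v) = a * dot u v.
Proof. by rewrite dotC dotZl dotC. Qed.

Lemma dot0r (R : realType) k (u : 'rV[R]_k) : dot u 0 = 0.
Proof. by rewrite dotE trmx0 mulmx0 mxE. Qed.

Definition dot_lin := (dotDl, dotDr, dotNl, dotNr, dotZl, dotZr).

Lemma dot_sumr (R : realType) (I : finType) k (u : 'rV[R]_k)
    (v : I -> 'rV[R]_k) : dot u (\sum_i v i) = \sum_i dot u (v i).
Proof.
apply: (big_morph (dot u)) => [v1 v2|]; [exact: dotDr|exact: dot0r].
Qed.

Lemma dot_mulmx_tr (R : realType) n k (x : 'rV[R]_n) (A : 'M[R]_(n, k))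
    (y : 'rV[R]_k) : dot (x *m A) y = dot x (y *m A^T).
Proof. by rewrite !dotE trmx_mul trmxK mulmxA. Qed.

Lemma dot_ge0 (R : realType) k (u : 'rV[R]_k) : 0 <= dot u u.
Proof. by apply: sumr_ge0 => j _; rewrite -expr2 sqr_ge0. Qed.

Lemma dot_eq0 (R : realType) k (u : 'rV[R]_k) : dot u u = 0 -> u = 0.
Proof.
move=> /psumr_eq0P u0; apply/rowP => j; rewrite mxE; apply/eqP.
by rewrite -sqrf_eq0 expr2 u0// => i _; rewrite -expr2 sqr_ge0.
Qed.

Lemma sqr_coord_le_dot (R : realType) k (u : 'rV[R]_k) j :
  u 0 j ^+ 2 <= dot u u.
Proof.
rewrite /dot (bigD1 j)//= expr2 lerDl.
by apply: sumr_ge0 => i _; rewrite -expr2 sqr_ge0.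
Qed.

Lemma dot_continuous (R : realType) (T : topologicalType) k
    (f g : T -> 'rV[R]_k) : continuous f -> continuous g ->
  continuous (fun x => dot (f x) (g x)).
Proof.
move=> cf cg x; rewrite /dot.
apply: cvg_big => [|j _]; first exact: add_continuous.
apply: (cvgM (continuous_cvg _ (@coord_continuous _ 1 k 0 j _) (cf x))).
exact: (continuous_cvg _ (@coord_continuous _ 1 k 0 j _) (cg x)).
Qed.

(** This covers both t -> 0 in an optimality condition and, after division by
    the step, steps tending to +oo along a ray (with t the inverse step). *)
Lemma affine_ge0_at0 (R : realType) (a b : R) :
  (forall t, 0 < t < 1 -> 0 <= a + t * b) -> 0 <= a.
Proof.
move=> ab; rewrite leNgt; apply/negP => a0.
have b0 : 0 <= `|b| by [].
have bb : b <= `|b| by exact: ler_norm.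
(* A t small enough that t * `|b| is at most - a / 2. *)
pose t := - a / (2 * (`|b| - a)).
have d0 : 0 < 2 * (`|b| - a) by lra.
have t01 : 0 < t < 1.
  by rewrite divr_gt0//=; [rewrite ltr_pdivrMr//; lra|lra].
have te : t * (2 * (`|b| - a)) = - a by rewrite mulfVK// gt_eqF.
have := ab _ t01; case/andP: t01 => t0 t1.
nra.
Qed.

(** * Epigraphs and the domain of the conjugate *)

Lemma epigraph_closed (R : realType) (X : topologicalType) (h : X -> \bar R) :
  lower_semicontinuous h -> closed [set q : X * R | (h q.1 <= q.2%:E)%E].
Proof.
move=> hl; rewrite -openC openE => -[z s] /= /negP; rewrite -ltNge => sz.
have [a sa az] : exists2 a, s < a & (a%:E < h z)%E.
  move: sz; case: (h z) => [r||//].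
    rewrite lte_fin => sr; exists ((s + r) / 2); first lra.
    by rewrite lte_fin; lra.
  by move=> _; exists (s + 1); [lra|exact: ltry].
have [V zV Va] := hl _ _ az.
exists (V, [set r | r < a]) => /=; first by split => //; exact: lt_nbhsl.
move=> [z' s'] [/= /Va az' s'a]; apply/negP; rewrite -ltNge.
by apply: lt_trans az'; rewrite lte_fin.
Qed.

(** The point (z0, h z0) of the epigraph is at distance 1 from (z0, h z0 - 1),
    so only the part of the epigraph in a box of radius 1 around the latter
    matters, and that part is compact. *)
Lemma epigraph_nearest (R : realType) k (h : 'rV[R]_k -> \bar R) z0 (r0 : R)
    (D := fun q : 'rV[R]_k * R =>
            dot (q.1 - z0) (q.1 - z0) + (q.2 - (r0 - 1)) ^+ 2) :
  lower_semicontinuous h -> h z0 = r0%:E ->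
  exists2 p : 'rV[R]_k * R, (h p.1 <= p.2%:E)%E &
    forall q, (h q.1 <= q.2%:E)%E -> D p <= D q.
Proof.
move=> hl hz0.
pose E := [set q : 'rV[R]_k * R | (h q.1 <= q.2%:E)%E].
pose B := [set z : 'rV[R]_k | forall j, z 0 j \in `[z0 0 j - 1, z0 0 j + 1]]
  `*` `[r0 - 2, r0].
have cB : compact B.
  apply: compact_setX; last exact: segment_compact.
  apply: (@rV_compact _ _ (fun j => `[z0 0 j - 1, z0 0 j + 1]%classic)) => j.
  exact: segment_compact.
have DB q : D q <= 1 -> B q.
  rewrite /D /= => Dq.
  have dq := dot_ge0 (q.1 - z0).
  split => /= [j|]; last by rewrite in_itv/=; nra.
  have := sqr_coord_le_dot (q.1 - z0) j; rewrite !mxE => dj.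
  rewrite in_itv/=; have := sqr_ge0 (q.2 - (r0 - 1)).
  nra.
have D0 : D (z0, r0) = 1.
  rewrite /D /= subrr dot0r add0r; ring.
have cEB : compact (E `&` B).
  apply: (subclosed_compact _ cB); last by move=> ? [].
  apply: closedI; first exact: epigraph_closed.
  by apply: compact_closed cB; exact: norm_hausdorff.
have cD : continuous D.
  have cfst : continuous (fun q : 'rV[R]_k * R => q.1 - z0).
    by move=> q; apply: cvgB; [exact: cvg_fst|exact: cvg_cst].
  have csnd : continuous (fun q : 'rV[R]_k * R => q.2 - (r0 - 1)).
    by move=> q; apply: cvgB; [exact: cvg_snd|exact: cvg_cst].
  have cdot := dot_continuous cfst cfst.
  move=> q; exact: (cvgD (cdot q) (cvgM (csnd q) (csnd q))).
have z0EB : (E `&` B) (z0, r0).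
  by split; [rewrite /E/= hz0|apply: DB; rewrite D0].
have [|p + pmin] := compact_EVT_min _ cEB (continuous_subspaceT cD).
  by exists (z0, r0).
rewrite inE => -[pE pB]; exists p => // q qE.
have [Dq|Dq] := leP (D q) 1.
  by apply: pmin; rewrite inE; split => //; exact: DB.
by rewrite (le_trans _ (ltW Dq))// -D0; apply: pmin; rewrite inE.
Qed.

Lemma conjugate_le (R : realType) k (h : 'rV[R]_k -> \bar R) v (K : R) :
  (forall z, ((dot v z - K)%:E <= h z)%E) -> (conjugate h v <= K%:E)%E.
Proof.
move=> hK; apply: ge_ereal_sup => _ [z _ <-].
have := hK z; case: (h z) => [r||//]; last by rewrite leNye.
by rewrite -EFinB !lee_fin; lra.
Qed.

Lemma le_conjugate (R : realType) k (h : 'rV[R]_k -> \bar R) v z (r : R) :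
  h z = r%:E -> ((dot v z - r)%:E <= conjugate h v)%E.
Proof.
by move=> hz; apply: ereal_sup_ubound; exists z => //; rewrite hz EFinB.
Qed.

Lemma proper_fun_fin (R : realType) (V : Type) (h : V -> \bar R) z :
  proper_fun h -> (h z < +oo)%E -> exists r, h z = r%:E.
Proof.
by case=> /(_ z); case: (h z) => // r _ _ _; exists r.
Qed.

Lemma conjugate_fin (R : realType) k (h : 'rV[R]_k -> \bar R) v :
  proper_fun h -> (conjugate h v < +oo)%E -> exists K, conjugate h v = K%:E.
Proof.
move=> hp; have [_ [z zh]] := hp.
have [r /(le_conjugate v)] := proper_fun_fin hp zh.
by case: (conjugate h v) => // K _ _; exists K.
Qed.

Lemma conjugate_approx (R : realType) k (h : 'rV[R]_k -> \bar R) v (K e : R) :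
  proper_fun h -> conjugate h v = K%:E -> 0 < e ->
  exists z r, h z = r%:E /\ K - e < dot v z - r.
Proof.
move=> [hNy _] hK e0.
have /ereal_sup_gt[_ [z _ <-]] : ((K - e)%:E < conjugate h v)%E.
  by rewrite hK lte_fin; lra.
have := hNy z; case hz: (h z) => [r||]// _.
by rewrite -EFinB lte_fin => ?; exists z, r.
Qed.

Lemma econvex_epigraph (R : realType) (V : lmodType R) (h : V -> \bar R)
    x y (r s t : R) : econvex h -> 0 < t < 1 ->
  (h x <= r%:E)%E -> (h y <= s%:E)%E ->
  (h (t *: x + (1 - t) *: y)%R <= (t * r + (1 - t) * s)%:E)%E.
Proof.
move=> hc t01 hx hy; apply: (le_trans (hc _ _ _ t01)).
have /andP[t0 t1] := t01.
by rewrite [leRHS]EFinD !EFinM leeD// lee_pmul2l ?lte_fin ?subr_gt0.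
Qed.

(** If (p, s) is the point of the epigraph nearest to (z0, h z0 - 1), the
    hyperplane through (p, s) orthogonal to the segment joining the two lies
    below the epigraph.  It is not vertical, because z0 itself is in the domain
    of h, so it is the graph of an affine minorant of h. *)
Lemma conjugate_dom_neq0 (R : realType) k (h : 'rV[R]_k -> \bar R) :
  proper_fun h -> lower_semicontinuous h -> econvex h ->
  exists v, (conjugate h v < +oo)%E.
Proof.
move=> hp hl hc; have [hNy [z0 z0h]] := hp.
have [r0 hz0] := proper_fun_fin hp z0h.
have [[p s] /= ps pmin] := epigraph_nearest hl hz0.
(* (a, b) is the normal vector of the supporting hyperplane at (p, s). *)
pose a := p - z0; pose b := s - (r0 - 1).
have normal z r : (h z <= r%:E)%E -> 0 <= dot a (z - p) + b * (r - s).
  move=> zr.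
  suff : 0 <= 2 * (dot a (z - p) + b * (r - s)) by lra.
  apply: (@affine_ge0_at0 _ _ (dot (z - p) (z - p) + (r - s) ^+ 2)) => t t01.
  have /andP[t0 t1] := t01.
  have /= := pmin (_, _) (econvex_epigraph hc t01 zr ps).
  have -> : t *: z + (1 - t) *: p - z0 = a + t *: (z - p).
    by apply/rowP => j; rewrite !mxE; ring.
  have -> : t * r + (1 - t) * s - (r0 - 1) = b + t * (r - s).
    by rewrite /b; ring.
  rewrite -/a -/b; clearbody a b; move: (z - p) => d.
  rewrite !dot_lin (dotC d a) => le.
  rewrite -(pmulr_rge0 _ t0); nra.
have b_gt0 : 0 < b.
  have := normal z0 r0; rewrite hz0 lexx => /(_ erefl).
  rewrite -[z0 - p]opprB -/a dotNr => le.
  have a0 := dot_ge0 a.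
  have b0 : 0 <= b by rewrite /b; rewrite /b in le; nra.
  rewrite lt_neqAle b0 andbT; apply/eqP => b0'.
  have /dot_eq0 /eqP : dot a a = 0 by rewrite -b0' in le; lra.
  rewrite subr_eq0 => /eqP pz0; move: ps; rewrite pz0 hz0 lee_fin.
  by move: b0'; rewrite /b; lra.
(* The slope of the hyperplane a . (z - p) + b * (r - s) = 0 solved for r. *)
clearbody a b; exists (- b^-1 *: a).
apply: (@le_lt_trans _ _ (- (s + b^-1 * dot a p))%:E); last exact: ltry.
apply: conjugate_le => z.
have [zh|] := ltP (h z) +oo%E; last by rewrite leye_eq => /eqP ->; rewrite leey.
have [r hz] := proper_fun_fin hp zh.
have := normal z r; rewrite hz lexx lee_fin => /(_ erefl).
rewrite !dot_lin => le.
have : 0 <= b^-1 * (dot a z - dot a p + b * (r - s)).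
  by apply: mulr_ge0 => //; rewrite invr_ge0 ltW.
rewrite mulrDr mulKf ?gt_eqF//; lra.
Qed.

Lemma conjugate_proper (R : realType) k (h : 'rV[R]_k -> \bar R) :
  proper_fun h -> lower_semicontinuous h -> econvex h ->
  proper_fun (conjugate h).
Proof.
move=> hp hl hc; split; last exact: conjugate_dom_neq0.
move=> v; have [_ [z zh]] := hp.
have [r /(le_conjugate v)] := proper_fun_fin hp zh.
by case: (conjugate h v).
Qed.

(** * Convexity of v . F and the tangent inequality *)

Definition convex_along (R : realType) n k (F : 'rV[R]_n -> 'rV[R]_k)
    (v : 'rV[R]_k) : Prop :=
  forall x y t, 0 < t < 1 ->
    dot v (F (t *: x + (1 - t) *: y))
    <= t * dot v (F x) + (1 - t) * dot v (F y).

(** Partial minimisation over u in g (F x + u) - v . u preserves convexity; near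
    minimisers stand in for the infimum, which need not be attained. *)
Lemma conjugate_convex_along (R : realType) n k (F : 'rV[R]_n -> 'rV[R]_k)
    (h : 'rV[R]_k -> \bar R) v :
  proper_fun h ->
  econvex (fun xu : 'rV[R]_n * 'rV[R]_k => h (F xu.1 + xu.2)) ->
  (conjugate h v < +oo)%E -> convex_along F v.
Proof.
move=> hp hc /(conjugate_fin hp)[K hK] x y t t01.
have /andP[t0 t1] := t01.
apply/ler_addgt0Pr => e e0.
have [zx [rx [hx Kx]]] := conjugate_approx hp hK e0.
have [zy [ry [hy Ky]]] := conjugate_approx hp hK e0.
(* The shifts u = zx - F x and u = zy - F y make F x + u and F y + u equal to
   the near maximisers zx and zy of z |-> v . z - h z. *)
have := @econvex_epigraph _ _ _ (x, zx - F x) (y, zy - F y) rx ry t hc t01.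
rewrite /= !subrKC hx hy !lexx => /(_ erefl erefl).
set z := F _ + _ => hz.
have [r hr] := proper_fun_fin hp (le_lt_trans hz (ltry _)).
have := le_conjugate v hr; rewrite hK lee_fin.
move: hz; rewrite hr lee_fin /z !dot_lin; nra.
Qed.

(** The difference quotients of a convex function along the segment from w to x
    are bounded by its increment from w to x, hence so is the directional
    derivative. *)
Lemma convex_along_tangent (R : realType) n k (F : 'rV[R]_n -> 'rV[R]_k) v w x :
  differentiable F w -> convex_along F v ->
  dot x (v *m ('J F w)^T) - Fnabla F v w <= dot v (F x).
Proof.
move=> dF Fv.
suff : dot v ((x - w) *m 'J F w) <= dot v (F x) - dot v (F w).
  rewrite /Fnabla -dot_mulmx_tr mulmxBl !dot_lin !(dotC v); lra.
have dq : h^-1 *: (F (h *: (x - w) + w) - F w) @[h --> 0^'+]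
    --> (x - w) *m 'J F w.
  rewrite -deriveEjacobian//; apply: cvg_dnbhs_at_right.
  exact: (diff_derivable (v := x - w) dF).
have dotq : dot v (h^-1 *: (F (h *: (x - w) + w) - F w)) @[h --> 0^'+]
    --> dot v ((x - w) *m 'J F w).
  have cdot : continuous (dot v).
    have cv : continuous (fun _ : 'rV[R]_k => v).
      exact: cst_continuous.
    have cid : continuous (fun z : 'rV[R]_k => z).
      by move=> z; exact: cvg_id.
    exact: (dot_continuous cv cid).
  exact: (cvg_comp _ _ dq (cdot _)).
apply: (cvgr_to_le dotq).
near=> t.
have t0 : 0 < t by [].
have t1 : t < 1 by near: t; exact: nbhs_right_lt.
have t01 : 0 < t < 1 by rewrite t0.
have := Fv x w t t01.
have -> : t *: x + (1 - t) *: w = t *: (x - w) + w.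
  by apply/rowP => j; rewrite !mxE; ring.
move=> le; rewrite /= (dotZr t^-1) dotDr dotNr ler_pdivrMl//; lra.
Unshelve. all: by end_near. Qed.

(** * Horizon functions *)

(** Along z + t d the affine minorant gives a difference quotient of at least
    dot d a + O(1 / t), whatever the base point z. *)
Lemma horizon_ge (R : realType) k (h : 'rV[R]_k -> \bar R) a (b : R) d :
  (forall z, ((dot z a - b)%:E <= h z)%E) -> (exists z, (h z < +oo)%E) ->
  ((dot d a)%:E <= horizon h d)%E.
Proof.
move=> hab [z1 hz1].
rewrite /horizon; set z := xget _ _.
have hz : (h z < +oo)%E.
  exact: (@xgetI _ 0 [set z | (h z < +oo)%E] z1).
have [r hr] : exists r, h z = r%:E.
  by have := hab z; move: hz; case: (h z) => // r; exists r.
set H := ereal_sup _.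
(* s is the inverse of the step t. *)
have slope s : 0 < s -> ((dot d a + s * (dot z a - b - r))%:E <= H)%E.
  move=> s0; have t0 : 0 < s^-1 by rewrite invr_gt0.
  apply: (@le_trans _ _ ((h (z + s^-1 *: d)%R - h z) * s%:E)%E); last first.
    by apply: ereal_sup_ubound; exists s^-1 => //; rewrite invrK.
  have := hab (z + s^-1 *: d); rewrite hr.
  case: (h _) => [q||//]; last by rewrite addye// gt0_mulye ?leey ?lte_fin.
  rewrite -EFinB -EFinM !lee_fin !dot_lin => le.
  have : s * (dot z a + s^-1 * dot d a - b) <= s * q by rewrite ler_pM2l.
  by rewrite mulrBr mulrDr mulVKf ?gt_eqF//; lra.
clearbody H; move: slope; case: H => [H||].
- move=> slope; rewrite lee_fin -subr_ge0.
  apply: (@affine_ge0_at0 _ _ (- (dot z a - b - r))) => t /andP[t0 _].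
  by have := slope _ t0; rewrite lee_fin; lra.
- by rewrite leey.
- by move=> /(_ 1 ltr01).
Qed.

Lemma horizon_le (R : realType) k (h : 'rV[R]_k -> \bar R) d (q : R) :
  proper_fun h -> (horizon h d <= q%:E)%E ->
  exists z r, h z = r%:E /\
    forall t, 0 < t -> (h (z + t *: d)%R <= (r + t * q)%:E)%E.
Proof.
move=> hp; have [hNy [z1 hz1]] := hp.
rewrite /horizon; set z := xget _ _ => Hq.
have hz : (h z < +oo)%E.
  exact: (@xgetI _ 0 [set z | (h z < +oo)%E] z1).
have [r hr] := proper_fun_fin hp hz.
exists z, r; split => // t t0.
have : ((h (z + t *: d)%R - h z) * (t^-1)%:E <= q%:E)%E.
  by apply: le_trans Hq; apply: ereal_sup_ubound; exists t.
have := hNy (z + t *: d); rewrite hr; case: (h _) => [s||]// _.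
  rewrite -EFinB -EFinM !lee_fin ler_pdivrMr//; lra.
by rewrite addye// gt0_mulye ?lte_fin ?invr_gt0.
Qed.

(** * The bounds on one block *)

(** v in the domain of the conjugate makes h o F lie above an affine function of
    slope v *m ('J F w)^T: the Fenchel-Young inequality bounds h o F below by
    v . F minus a constant, and the tangent inequality bounds v . F. *)
Lemma horizon_comp_ge (R : realType) n k (F : 'rV[R]_n -> 'rV[R]_k)
    (h : 'rV[R]_k -> \bar R) v w x :
  (exists z, (h (F z) < +oo)%E) -> proper_fun h ->
  econvex (fun xu : 'rV[R]_n * 'rV[R]_k => h (F xu.1 + xu.2)) ->
  differentiable F w -> (conjugate h v < +oo)%E ->
  ((dot x (v *m ('J F w)^T))%:E <= horizon (h \o F) x)%E.
Proof.
move=> Fh hp hc dF hv.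
have [K hK] := conjugate_fin hp hv.
apply: (@horizon_ge _ _ _ _ (Fnabla F v w + K)) => // z /=.
have [Fz|] := ltP (h (F z)) +oo%E; last first.
  by rewrite leye_eq => /eqP ->; rewrite leey.
have [r hr] := proper_fun_fin hp Fz.
have := convex_along_tangent z dF (conjugate_convex_along hp hc hv).
by have := le_conjugate v hr; rewrite hr hK !lee_fin; lra.
Qed.

(** The direction v need not lie in the domain of the conjugate, but u + t v
    does for all t > 0 when the horizon value is finite; convexity of
    (u + t v) . F passes to v . F after division by t, as t tends to +oo. *)
Lemma horizon_conjugate_ge (R : realType) n k
    (F : 'rV[R]_n -> 'rV[R]_k) (h : 'rV[R]_k -> \bar R) v w x :
  proper_fun h -> lower_semicontinuous h -> econvex h ->
  econvex (fun xu : 'rV[R]_n * 'rV[R]_k => h (F xu.1 + xu.2)) ->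
  differentiable F w -> (h (F x) < +oo)%E ->
  ((dot x (v *m ('J F w)^T))%:E
    <= (Fnabla F v w)%:E + horizon (conjugate h) v)%E.
Proof.
move=> hp hl hc hFc dF Fx.
have hsp := conjugate_proper hp hl hc.
(* Bounding by every real upper bound q of the horizon value covers its three
   cases at once; the value -oo contradicts the bound for q small. *)
suff below q : (horizon (conjugate h) v <= q%:E)%E ->
    dot x (v *m ('J F w)^T) <= Fnabla F v w + q.
  move: below; case: (horizon _ _) => [H||] below.
  - by rewrite -EFinD lee_fin below.
  - by rewrite addey// leey.
  - exfalso.
    have := below (dot x (v *m ('J F w)^T) - Fnabla F v w - 1) (leNye _).
    lra.
move=> /(horizon_le hsp)[u [K [_ ray]]].
have Fv : convex_along F v.
  move=> y z t t01; rewrite -subr_ge0.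
  set X := F (_ + _).
  apply: (@affine_ge0_at0 _ _
    (t * dot u (F y) + (1 - t) * dot u (F z) - dot u X)).
  move=> s /andP[s0 _].
  have s'0 : 0 < s^-1 by rewrite invr_gt0.
  have udom := le_lt_trans (ray _ s'0) (ltry _).
  have := conjugate_convex_along hp hFc udom y z t01.
  (* s is the inverse of the step along the ray from u in direction v. *)
  have vE p : dot v p = s * dot (u + s^-1 *: v) p - s * dot u p.
    by rewrite dotDl dotZl mulrDr mulVKf ?gt_eqF//; ring.
  by rewrite -/X !vE -(ler_pM2l s0); lra.
have vF : dot v (F x) <= q.
  have [r hr] := proper_fun_fin hp Fx.
  rewrite -subr_ge0; apply: (@affine_ge0_at0 _ _ (K + r - dot u (F x))).
  move=> s /andP[s0 _].
  have s'0 : 0 < s^-1 by rewrite invr_gt0.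
  have := le_trans (le_conjugate (u + s^-1 *: v) hr) (ray _ s'0).
  rewrite lee_fin !dot_lin -(ler_pM2l s0) mulrBr !mulrDr !mulVKf ?gt_eqF//.
  lra.
by have := convex_along_tangent x dF Fv; lra.
Qed.

Theorem theorem4 (R : realType) (I : finType) (n : nat) (m : I -> nat)
    (c : 'rV[R]_n)
    (F : forall i : I, 'rV[R]_n -> 'rV[R]_(m i))
    (g : forall i : I, 'rV[R]_(m i) -> \bar R)
    (g_F_finite : forall i, exists x : 'rV[R]_n, (g i (F i x) < +oo)%E)
    (F_C1 : forall i, continuously_differentiable (F i))
    (g_proper : forall i, proper_fun (g i))
    (g_closed : forall i, lower_semicontinuous (g i))
    (g_convex : forall i, econvex (g i))
    (gF_convex : forall i,
      econvex (fun xu : 'rV[R]_n * 'rV[R]_(m i) => g i (F i xu.1 + xu.2))) :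
  ((exists x : 'rV[R]_n, primal_ray c F g x) ->
   ~ exists (y : forall i, 'rV[R]_(m i)) (w : I -> 'rV[R]_n),
       dual_feasible c F g y w) /\
  ((exists (y : forall i, 'rV[R]_(m i)) (w : I -> 'rV[R]_n),
      dual_ray F g y w) ->
   ~ exists x : 'rV[R]_n, primal_feasible F g x).
Proof.
(* The bounds on the blocks sum up to a quantity fixed by the constraint on the
   dual variables. *)
have slopes (x : 'rV[R]_n) (y : forall i, 'rV[R]_(m i)) (w : I -> 'rV[R]_n) :
    (\sum_i (dot x (- y i *m ('J (F i) (w i))^T))%:E)%E
    = (- dot x (\sum_i y i *m ('J (F i) (w i))^T))%:E.
  rewrite sumEFin dot_sumr -sumrN; congr (_%:E).
  by apply: eq_bigr => i _; rewrite mulNmx dotNr.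
split.
- move=> [x xray] [y [w [yfin yc]]]; move: xray.
  rewrite /primal_ray; apply/negP; rewrite -leNgt.
  have le : ((- dot x c)%:E <= \sum_(i : I) horizon (g i \o F i) x)%E.
    rewrite -yc -slopes; apply: lee_sum => i _.
    by apply: horizon_comp_ge => //; exact: (F_C1 i).1.
  by apply: le_trans (leeD2l _ le); rewrite -EFinD dotC subrr.
- move=> [y [w [yw0 ray]]] [x xfeas]; move: ray.
  apply/negP; rewrite -leNgt oppe_le0.
  have dotx0 : 0%E = (- dot x 0)%:E by rewrite dot0r oppr0.
  rewrite [leLHS]dotx0 -yw0 -slopes; apply: lee_sum => i _.
  by apply: horizon_conjugate_ge => //; exact: (F_C1 i).1.
Qed.
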